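(* There are exactly five conjugacy classes of involutions in $\Pi A_2$. These conjugacy classes are represented by $$\sigma,\quad \sigma\delta,\quad \rho,\quad \mu_{12}\sigma,\quad \mu_{21}\sigma .$$
   Context: $F_2=\langle x,y\rangle$ is the free group of rank 2. A palindrome is a reduced word in $x^{\pm1},y^{\pm1}$ that equals its reverse word. $\Pi A_2\le\mathrm{Aut}(F_2)$ is the group of all automorphisms mapping each of $x,y$ to a palindrome. Automorphisms act on the right, so products are composed from left to right. The following elements of $\Pi A_2$ are used: $\mu_{12}: x\mapsto yxy,\ y\mapsto y$; $\mu_{21}: x\mapsto x,\ y\mapsto xyx$; $\sigma: x\mapsto x^{-1},\ y\mapsto y$; $\delta: x\mapsto x,\ y\mapsto y^{-1}$; $\rho: x\mapsto y,\ y\mapsto x$. An involution is an element of order 2. *)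

(* Defs.v *)
From HB Require Import structures.
From mathcomp Require Import all_boot.
From mathcomp Require Import boolp classical_sets functions cardinality.

Set Implicit Arguments.
Unset Strict Implicit.
Unset Printing Implicit Defensive.

Local Open Scope group_scope.

(* The letter (g, e) is the generator x (g = false) or y (g = true), or its
   formal inverse when e = true. *)
Definition letter := (bool * bool)%type.

Definition linv (l : letter) : letter := (l.1, ~~ l.2).

Definition reduced (w : seq letter) : bool :=
  sorted (fun l m => m != linv l) w.

(* Left multiplication of a reduced word by a letter, with cancellation. *)
Definition push (l : letter) (w : seq letter) : seq letter :=
  if w is m :: w' then if m == linv l then w' else l :: w else [:: l].

Definition inv_word (w : seq letter) : seq letter := rev (map linv w).

Lemma linvK : involutive linv. Proof. by case=> g []. Qed.

Lemma linv_neq l : linv l != l. Proof. by case: l => -[] []. Qed.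

Lemma reduced_push l w : reduced w -> reduced (push l w).
Proof.
case: w => [|m w] //= mw; case: eqP => [_|/eqP lm]; last by rewrite /= lm.
exact: path_sorted mw.
Qed.

Lemma reduced_foldr u v : reduced v -> reduced (foldr push v u).
Proof. by move=> v_red; elim: u => //= l u; exact: reduced_push. Qed.

Lemma reduced_inv w : reduced w -> reduced (inv_word w).
Proof.
rewrite /reduced /inv_word rev_sorted sorted_map; apply: sub_sorted => l m /=.
by apply: contraNN => /eqP; rewrite linvK => <-.
Qed.

Lemma pushK l w : reduced w -> push l (push (linv l) w) = w.
Proof.
case: w => [|m w] /=; first by rewrite eqxx.
rewrite linvK; case: eqP => [->|_ _]; last by rewrite /= eqxx.
by case: w => //= n w /andP[/negPf ->].
Qed.

Lemma foldr_push_red u : reduced u -> foldr push [::] u = u.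
Proof.
elim: u => // l u IHu lu.
rewrite [LHS]/= (IHu (path_sorted lu)).
by case: u lu {IHu} => //= m u /andP[/negPf ->].
Qed.

Lemma foldr_push_mul u v w : reduced w ->
  foldr push w (foldr push v u) = foldr push (foldr push w v) u.
Proof.
move=> w_red; elim: u => //= l u <-.
case: (foldr push v u) => //= m z; case: eqP => //= ->.
by rewrite pushK // reduced_foldr.
Qed.

Lemma foldr_push_inv u : foldr push u (inv_word u) = [::].
Proof.
elim: u => //= l u IHu.
by rewrite /inv_word map_cons rev_cons foldr_rcons /= linvK eqxx.
Qed.

Lemma inv_wordK : involutive inv_word.
Proof. by move=> w; rewrite /inv_word map_rev revK (mapK linvK). Qed.

Record F2 := Word { word : seq letter; word_reduced : reduced word }.

HB.instance Definition _ := [isSub for word].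
HB.instance Definition _ := [Countable of F2 by <:].

Definition F2_one : F2 := @Word [::] isT.
Definition F2_mul (u v : F2) : F2 :=
  Word (reduced_foldr (word u) (word_reduced v)).
Definition F2_inv (u : F2) : F2 := Word (reduced_inv (word_reduced u)).

Lemma F2_mulA : associative F2_mul.
Proof.
by move=> u v w; apply: val_inj; rewrite /= foldr_push_mul ?word_reduced.
Qed.

Lemma F2_mul1 : left_id F2_one F2_mul.
Proof. by move=> u; apply: val_inj. Qed.

Lemma F2_mulr1 : right_id F2_one F2_mul.
Proof.
by move=> u; apply: val_inj; rewrite /= foldr_push_red ?word_reduced.
Qed.

Lemma F2_mulV : left_inverse F2_one F2_inv F2_mul.
Proof. by move=> u; apply: val_inj; rewrite /= foldr_push_inv. Qed.

Lemma F2_mulrV : right_inverse F2_one F2_inv F2_mul.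
Proof.
move=> u; apply: val_inj => /=.
by have := foldr_push_inv (inv_word (word u)); rewrite inv_wordK.
Qed.

HB.instance Definition _ :=
  isGroup.Build F2 F2_mulA F2_mul1 F2_mulr1 F2_mulV F2_mulrV.

Definition F2_letter (l : letter) : F2 := @Word [:: l] isT.
Definition x : F2 := F2_letter (false, false).
Definition y : F2 := F2_letter (true, false).

Lemma F2_letterV l : F2_letter (linv l) = (F2_letter l)^-1.
Proof. exact: val_inj. Qed.

Lemma F2E (u : F2) : u = foldr (fun l v => F2_letter l * v) 1 (word u).
Proof.
case: u => u u_red; apply: val_inj => /=.
rewrite -{1}(foldr_push_red u_red).
by elim: u {u_red} => [|l u IHu] //=; rewrite IHu.
Qed.

Section Evaluation.
Variables (G : groupType) (a b : G).

Definition F2_eval_letter (l : letter) : G :=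
  let c := if l.1 then b else a in if l.2 then c^-1 else c.

(* The homomorphism F2 -> G with x |-> a and y |-> b. *)
Definition F2_eval (u : F2) : G :=
  foldr (fun l g => F2_eval_letter l * g) 1 (word u).

Lemma F2_eval_letterV l : F2_eval_letter (linv l) = (F2_eval_letter l)^-1.
Proof. by case: l => g [] //=; rewrite /F2_eval_letter /= invgK. Qed.

Lemma F2_evalM : {morph F2_eval : u v / u * v}.
Proof.
move=> u v; rewrite /F2_eval /=; elim: (word u) => [|l w IHw] /=.
  by rewrite mul1g.
rewrite -mulgA -IHw; case: (foldr push _ w) => //= m z.
by case: eqP => //= ->; rewrite F2_eval_letterV mulVKg.
Qed.

Lemma F2_eval_x : F2_eval x = a. Proof. exact: mulg1. Qed.

Lemma F2_eval_y : F2_eval y = b. Proof. exact: mulg1. Qed.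

End Evaluation.

Lemma morphg1 (G H : groupType) (f : G -> H) :
  {morph f : u v / u * v} -> f 1 = 1.
Proof. by move=> fM; apply: (mulgI (f 1)); rewrite -fM !mulg1. Qed.

Lemma morphgV (G H : groupType) (f : G -> H) :
  {morph f : u v / u * v} -> {morph f : u / u^-1}.
Proof.
by move=> fM u; apply: (mulgI (f u)); rewrite -fM !mulgV (morphg1 fM).
Qed.

Lemma F2_morph_ext (G : groupType) (f g : F2 -> G) :
  {morph f : u v / u * v} -> {morph g : u v / u * v} ->
  f x = g x -> f y = g y -> f =1 g.
Proof.
move=> fM gM fgx fgy u; rewrite [u]F2E.
elim: (word u) => [|l w IHw]; first by rewrite /= !morphg1.
rewrite /= fM gM IHw; congr (_ * _).
have: F2_letter l \in [:: x; y; x^-1; y^-1] by case: l => -[] [].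
by rewrite !inE => /or4P[] /eqP ->; rewrite ?morphgV ?fgx ?fgy.
Qed.

Definition automorphism (G : groupType) (f : G -> G) : Prop :=
  bijective f /\ {morph f : u v / u * v}.

Record Aut (G : groupType) :=
  MkAut { aut_fun :> G -> G; aut_funP : `[< automorphism aut_fun >] }.

HB.instance Definition _ (G : groupType) := [isSub for @aut_fun G].
HB.instance Definition _ (G : groupType) := [Choice of Aut G by <:].

Section AutGroup.
Variable G : groupType.
Implicit Types f g h : Aut G.

Lemma autP f : automorphism f. Proof. exact/asboolP/aut_funP. Qed.

Lemma aut_bij f : bijective f. Proof. by case: (autP f). Qed.

Lemma autM f : {morph f : u v / u * v}. Proof. by case: (autP f). Qed.

Lemma eq_aut f g : f =1 g -> f = g.
Proof. by move=> fg; apply: val_inj; apply/funext. Qed.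

Lemma aut_one_subproof : `[< automorphism (@id G) >].
Proof. by apply/asboolP; split=> //; exists id. Qed.
Definition aut_one : Aut G := MkAut aut_one_subproof.

(* Automorphisms act on the right: f * g is "f, then g". *)
Lemma aut_mul_subproof f g : `[< automorphism (fun u => g (f u)) >].
Proof.
apply/asboolP; split; first exact: bij_comp (aut_bij g) (aut_bij f).
by move=> u v; rewrite !autM.
Qed.
Definition aut_mul f g : Aut G := MkAut (aut_mul_subproof f g).

Lemma aut_inv_subproof f :
  {g : Aut G | cancel f g & cancel g f}.
Proof.
suff /cid2[g fg gf] : exists2 g : Aut G, cancel f g & cancel g f by exists g.
have [g fg gf] := aut_bij f.
have gP : `[< automorphism g >].
  apply/asboolP; split=> [|u v]; first by exists f.
  by apply: (can_inj fg); rewrite autM !gf.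
by exists (MkAut gP).
Qed.
Definition aut_inv f : Aut G := s2val (aut_inv_subproof f).

Lemma autK f : cancel f (aut_inv f).
Proof. exact: s2valP (aut_inv_subproof f). Qed.

Lemma autKV f : cancel (aut_inv f) f.
Proof. exact: s2valP' (aut_inv_subproof f). Qed.

Lemma aut_mulA : associative aut_mul.
Proof. by move=> f g h; apply: eq_aut. Qed.

Lemma aut_mul1 : left_id aut_one aut_mul.
Proof. by move=> f; apply: eq_aut. Qed.

Lemma aut_mulr1 : right_id aut_one aut_mul.
Proof. by move=> f; apply: eq_aut. Qed.

Lemma aut_mulV : left_inverse aut_one aut_inv aut_mul.
Proof. by move=> f; apply: eq_aut => u /=; rewrite autKV. Qed.

Lemma aut_mulrV : right_inverse aut_one aut_inv aut_mul.
Proof. by move=> f; apply: eq_aut => u /=; rewrite autK. Qed.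

HB.instance Definition _ :=
  isGroup.Build (Aut G) aut_mulA aut_mul1 aut_mulr1 aut_mulV aut_mulrV.

End AutGroup.

Definition palindrome (u : F2) : bool := rev (word u) == word u.

Definition palindromic (f : Aut F2) : bool :=
  palindrome (f x) && palindrome (f y).

(* The automorphism inverting both generators; ΠA_2 is its centraliser. *)
Lemma reduced_iota (u : F2) : reduced (map linv (word u)).
Proof.
have := word_reduced u; rewrite /reduced sorted_map.
apply: sub_sorted => l m /=; apply: contraNN => /eqP.
by move/(can_inj linvK) => ->.
Qed.
Definition iota_aut (u : F2) : F2 := Word (reduced_iota u).

Lemma iota_autM : {morph iota_aut : u v / u * v}.
Proof.
move=> u v; apply: val_inj => /=; elim: (word u) => //= l w <-.
case: (foldr push (word v) w) => //= m z.
by rewrite (inj_eq (can_inj linvK)); case: eqP.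
Qed.

Lemma palindromeE u : palindrome u = (iota_aut u == u^-1).
Proof.
rewrite -val_eqE /= /palindrome /inv_word -map_rev (inj_eq (inj_map _)).
  by rewrite eq_sym.
exact: can_inj linvK.
Qed.

Lemma palindromicE (f : Aut F2) :
  palindromic f <-> forall u, f (iota_aut u) = iota_aut (f u).
Proof.
have iotax : iota_aut x = x^-1 by apply: val_inj.
have iotay : iota_aut y = y^-1 by apply: val_inj.
rewrite /palindromic !palindromeE; split=> [/andP[/eqP fx /eqP fy]|fi].
  apply: F2_morph_ext => [u v|u v||]; rewrite ?iota_autM ?autM ?iota_autM //.
    by rewrite iotax fx (morphgV (@autM _ f)).
  by rewrite iotay fy (morphgV (@autM _ f)).
by rewrite -!fi iotax iotay !(morphgV (@autM _ f)) !eqxx.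
Qed.

Lemma palindromic_group_closed : group_closed palindromic.
Proof.
split=> [|f g /palindromicE fi /palindromicE gi]; first exact/palindromicE.
apply/palindromicE => u /=.
by apply: (can_inj (autK g)); rewrite gi !autKV.
Qed.

Record PiA2 := MkPiA2 { PiA2_aut :> Aut F2; _ : palindromic PiA2_aut }.

HB.instance Definition _ := [isSub for PiA2_aut].
HB.instance Definition _ := [Choice of PiA2 by <:].
HB.instance Definition _ :=
  SubChoice_isSubGroup.Build (Aut F2) palindromic PiA2
    palindromic_group_closed.

Section Generators.
Variables a b c d : F2.

(* x |-> a, y |-> b is a palindromic automorphism with inverse x |-> c,
   y |-> d. *)
Definition PiA2_cond : bool :=
  [&& F2_eval c d a == x, F2_eval c d b == y, F2_eval a b c == x,
      F2_eval a b d == y, palindrome a & palindrome b].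

Hypothesis abcd : PiA2_cond.

Lemma F2_eval_aut : `[< automorphism (F2_eval a b) >].
Proof.
case/and5P: abcd => /eqP ax /eqP bY /eqP cx /eqP dy _.
apply/asboolP; split; last exact: F2_evalM.
exists (F2_eval c d).
  apply: (@F2_morph_ext _ (fun u => F2_eval c d (F2_eval a b u)) id) => //.
  - by move=> u v; rewrite !F2_evalM.
  - by rewrite F2_eval_x.
  - by rewrite F2_eval_y.
apply: (@F2_morph_ext _ (fun u => F2_eval a b (F2_eval c d u)) id) => //.
- by move=> u v; rewrite !F2_evalM.
- by rewrite F2_eval_x.
- by rewrite F2_eval_y.
Qed.

Lemma F2_eval_palindromic : palindromic (MkAut F2_eval_aut).
Proof.
by case/and5P: abcd => _ _ _ _ /andP[pa pb];
  rewrite /palindromic /= F2_eval_x F2_eval_y pa pb.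
Qed.

Definition PiA2_of : PiA2 := MkPiA2 F2_eval_palindromic.

End Generators.

Definition mu12 : PiA2 :=
  @PiA2_of (y * x * y) y (y^-1 * x * y^-1) y isT.
Definition mu21 : PiA2 :=
  @PiA2_of x (x * y * x) x (x^-1 * y * x^-1) isT.
Definition sigma : PiA2 := @PiA2_of x^-1 y x^-1 y isT.
Definition delta : PiA2 := @PiA2_of x y^-1 x y^-1 isT.
Definition rho : PiA2 := @PiA2_of y x y x isT.

Section Involutions.
Variable G : groupType.

Definition has_order (g : G) (n : nat) : Prop :=
  [/\ (0 < n)%N, g ^+ n = 1 & forall m, (0 < m < n)%N -> g ^+ m <> 1].

Definition involution (g : G) : Prop := has_order g 2.

Definition conj_class (g : G) : set G := [set g ^ h | h in [set: G]].

Definition involution_classes : set (set G) :=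
  [set C | exists2 g, involution g & C = conj_class g].

End Involutions.

Arguments involution_classes G : clear implicits.

(* Main.v *)
Require Import Defs.
From mathcomp Require Import all_boot all_algebra zify ring.
From mathcomp Require Import boolp classical_sets functions cardinality.

Set Implicit Arguments.
Unset Strict Implicit.
Unset Printing Implicit Defensive.

Import GRing.Theory Num.Theory.

Local Open Scope group_scope.

(** A palindromic automorphism f acts on the abelianization of F2 by an
    integer matrix of determinant 1 or -1.  Mod 2, this matrix is the identity
    or the swap, because a palindrome cannot have two odd exponent sums.  The
    theorem is a statement about such matrices as soon as f is known to be
    determined by its matrix ([entry_inj]), and most of the work goes there.

    Faithfulness.  Let u = f x and v = f y.  Powers of a palindrome never
    cancel, and out of u v and u^-1 v at most one product cancels, so a single
    number p, the length of the common prefix of u and v (after replacing u by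
    its inverse if needed), measures all cancellation.  If p is less than half
    of both lengths then the pair is Nielsen reduced and generates F2, so that
    u and v are letters ([reduced_pair]).  Otherwise p is more than half of
    the smaller length, since these lengths are odd.  Then u and v coincide if
    they have the same length, which is absurd, and if u is shorter than v
    then u^-1 v u^-1 is shorter than v as well ([descent]).  Undoing this step adds twice the row of u
    to the row of v, and a convexity argument shows that the l1 norms of
    the two rows are ordered as the lengths of u and v ([norm1_lt]).  If the
    matrix is the identity, both norms are 1, hence u and v have the same
    length, hence they are letters, hence f = 1.

    Classification.  The matrix of an involution is -1, which is the matrix of
    sigma delta, or has trace 0: (a, b; c, -a) with a^2 + bc = 1.  Conjugation
    by mu12 and its inverse changes a by 2c in either direction, and rho
    exchanges b and c.  When |a| > 1 one of |b|, |c| lies strictly between 0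
    and |a|, so a Euclidean descent leads to |a| <= 1 ([represented_trace0]).
    For a = 0 this is rho or its conjugate; for |a| = 1 the matrix is, up to
    rho, upper triangular, its even off-diagonal entry matters only mod 4, and the four
    remaining matrices give sigma, mu12 sigma and mu21 sigma
    ([represented_triangular]).

    Separation.  If two representatives with matrices A and B are conjugate
    by h with matrix H then A H = H B.  In each case these linear equations
    are incompatible with H being the identity or the swap mod 2
    ([conj_class_reps_inj]).  *)

(** * Common prefixes and palindromic sequences *)

Fixpoint lcp (T : eqType) (s t : seq T) : nat :=
  if (s, t) is (a :: s', b :: t') then
    if a == b then (lcp s' t').+1 else 0
  else 0.

Section CommonPrefix.
Variable T : eqType.
Implicit Types s t r : seq T.

Lemma lcpC s t : lcp s t = lcp t s.
Proof.
by elim: s t => [|a s IHs] [|b t] //=; rewrite eq_sym IHs.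
Qed.

Lemma lcp_ultra s t r : (minn (lcp s t) (lcp t r) <= lcp s r)%N.
Proof.
elim: s t r => [|a s IHs] [|b t] [|c r] //=; rewrite ?minn0 ?min0n //.
case: (a =P b) => [->|_]; last by rewrite min0n.
by case: eqP => _; rewrite ?minn0 ?minnSS // ltnS.
Qed.

Lemma lcp_map (T' : eqType) (h : T -> T') s t :
  injective h -> lcp (map h s) (map h t) = lcp s t.
Proof.
by move=> h_inj; elim: s t => [|a s IHs] [|b t] //=; rewrite (inj_eq h_inj) IHs.
Qed.

Lemma lcp_take s t : take (lcp s t) s = take (lcp s t) t.
Proof. by elim: s t => [|a s IHs] [|b t] //=; case: eqP => //= ->; rewrite IHs. Qed.

(** The common prefix fixes one half of both sequences, and the mirror image
    fixes the other half. *)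
Lemma pal_eq_half s t : rev s = s -> rev t = t -> size s = size t ->
  (size s <= 2 * lcp s t)%N -> s = t.
Proof.
move=> sP tP szst half; have [s0|] := posnP (size s).
  by rewrite [s]size0nil // [t]size0nil // -szst.
case: s sP szst half => // a0 s sP szst half _.
apply: (@eq_from_nth _ a0) => // i ilt.
have low j : (j < lcp (a0 :: s) t)%N -> nth a0 (a0 :: s) j = nth a0 t j.
  by move=> jlt; rewrite -(nth_take a0 jlt) lcp_take nth_take.
have [/low //|ige] := ltnP i (lcp (a0 :: s) t).
rewrite -{1}sP -{1}tP !nth_rev -?szst // low //.
by move: half ige ilt; move: (lcp _ _) (size _) => n m; lia.
Qed.

(** The two halves of the sequence are mirror images. *)
Lemma pal_even_count (P : pred T) s :
  rev s = s -> ~~ odd (size s) -> ~~ odd (count P s).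
Proof.
move=> sP sz; have szs : size s = ((size s)./2 + (size s)./2)%N by lia.
have := count_rev P (take (size s)./2 s).
have -> : count P s =
    (count P (take (size s)./2 s) + count P (drop (size s)./2 s))%N.
  by rewrite -count_cat cat_take_drop.
have -> : rev (take (size s)./2 s) = drop (size s)./2 s.
  by rewrite -[in RHS]sP size_rev drop_rev {2}szs addnK.
by move=> ->; lia.
Qed.

End CommonPrefix.

(** * Cancellation in the free group *)

Definition len (u : F2) : nat := size (word u).
Definition overlap (u v : F2) : nat := lcp (word u) (word v).

Arguments len u%_g.
Arguments overlap (u v)%_g.

Lemma overlapC u v : overlap u v = overlap v u.
Proof. exact: lcpC. Qed.

(** Together with [len_mulVg], this turns the length estimates below into
    linear arithmetic. *)
Lemma overlap_ultra u v w :
  (minn (overlap u v) (overlap v w) <= overlap u w)%N.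
Proof. exact: lcp_ultra. Qed.

Lemma lenV (u : F2) : len u^-1 = len u.
Proof. by rewrite /len /= size_rev size_map. Qed.

Lemma len_eq0 u : (len u == 0%N) = (u == 1).
Proof. by rewrite -val_eqE /=; apply: size_eq0. Qed.

Lemma len_eq1 u : len u = 1%N -> exists l, u = F2_letter l.
Proof.
rewrite /len; case: u => -[|l []] // w_red _.
by exists l; apply: val_inj.
Qed.

(** A letter of s either cancels against the head of t, and then it is part of
    the common prefix, or it blocks all further cancellation. *)
Lemma size_push_inv s t : reduced s -> reduced t ->
  (size (foldr push t (inv_word s)) + 2 * lcp s t = size s + size t)%N.
Proof.
elim: s t => [|l s IHs] t s_red t_red; first by rewrite /= addn0.
rewrite /inv_word map_cons rev_cons foldr_rcons -/(inv_word s).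
have := IHs _ (path_sorted s_red) (reduced_push (linv l) t_red).
case: t t_red => [|m t] _ /=; last rewrite linvK eq_sym.
  have -> : lcp s [:: linv l] = 0%N.
    by case: s s_red {IHs} => //= k s /andP[/negPf->].
  lia.
case: eqP => _ /=; first lia.
have -> : lcp s (linv l :: m :: t) = 0%N.
  by case: s s_red {IHs} => //= k s /andP[/negPf->].
rewrite /=; lia.
Qed.

Lemma len_mulVg (u v : F2) : (len (u^-1 * v) + 2 * overlap u v = len u + len v)%N.
Proof. exact: size_push_inv (word_reduced u) (word_reduced v). Qed.

(** Inductive step for products of Nielsen reduced factors.  The last
    hypothesis says that g keeps all of its first factor v except for at most
    p letters; since v is longer than 2p, the factor u cannot cancel past what
    it cancels in v alone, and it survives in the same sense. *)
Lemma nielsen_step (u v g : F2) p :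
    (2 * p < len u)%N -> (2 * p < len v)%N -> (overlap u^-1 v <= p)%N ->
    (len v <= overlap g v + p)%N ->
  (len g < len (u * g))%N /\ (len u <= overlap (u * g) u + p)%N.
Proof.
move=> cu cv uv gv; have u1 := overlap_ultra u^-1 g v.
have e1 : (len (u * g) + 2 * overlap u^-1 g = len u + len g)%N.
  by have := len_mulVg u^-1 g; rewrite invgK lenV.
have e2 : (len g + 2 * overlap (u * g) u = len (u * g) + len u)%N.
  by have := len_mulVg (u * g) u; rewrite invgM mulgVK lenV.
lia.
Qed.

Section Reduced.
Variables (f : Aut F2) (p : nat).

Hypothesis core : forall l, (2 * p < len (f (F2_letter l)))%N.
Hypothesis small : forall l m, m != linv l ->
  (overlap (f (F2_letter l))^-1 (f (F2_letter m)) <= p)%N.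

(** Each factor keeps a nonempty core in f w, so no letter of w is lost. *)
Lemma nielsen_len_ge (w : F2) : (len w <= len (f w))%N.
Proof.
pose F s := foldr (fun l g => f (F2_letter l) * g) 1 s.
have fF : f w = F (word w).
  rewrite {1}[w]F2E; elim: (word w) => [|l s IHs] /=.
    exact: (morphg1 (@autM _ f)).
  by rewrite autM IHs.
suff main l s : reduced (l :: s) -> (size (l :: s) <= len (F (l :: s)))%N /\
    (len (f (F2_letter l)) <= overlap (F (l :: s)) (f (F2_letter l)) + p)%N.
  rewrite fF /len; case: (word w) (word_reduced w) => // l s lsR.
  by have [] := main l s lsR.
elim: s l => [|m s IHs] l.
  rewrite /F /= mulg1 => _; have := core l.
  have := len_mulVg (f (F2_letter l)) (f (F2_letter l)).
  rewrite mulVg; have -> : len 1 = 0%N by []. lia.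
move=> /andP[lm ms_red]; have [szm ovm] := IHs m ms_red.
have -> : F [:: l, m & s] = f (F2_letter l) * F (m :: s) by [].
have [lt_len] := nielsen_step (core l) (core m) (small lm) ovm.
by split; first exact: leq_ltn_trans szm lt_len.
Qed.

(** The letters are values of f by surjectivity, and a preimage of a letter is
    no longer than its image, so f permutes the four letters. *)
Lemma nielsen_basis : len (f x) = 1%N /\ len (f y) = 1%N.
Proof.
have letter l : exists m, f (F2_letter m) = F2_letter l.
  have [w wl] : exists w, f w = F2_letter l.
    by have [g _ fK] := aut_bij f; exists (g (F2_letter l)).
  have /len_eq1[m wm] : len w = 1%N.
    have := nielsen_len_ge w; rewrite wl.
    case: (len w =P 0%N) => [/eqP|].
      rewrite len_eq0 => /eqP w0; move: wl; rewrite w0 => wl.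
      by have := congr1 len (etrans (esym wl) (morphg1 (@autM _ f))).
    have -> : len (F2_letter l) = 1%N by [].
    lia.
  by exists m; rewrite -wm.
have lenf m n : f (F2_letter m) = F2_letter n ->
    len (f (F2_letter (m.1, false))) = 1%N.
  case: m => a [] e; last by rewrite e.
  by rewrite -lenV -(morphgV (@autM _ f)) -F2_letterV e.
have [mx ex] := letter (false, false); have [my ey] := letter (true, false).
have nxy : mx.1 != my.1.
  apply/eqP => mxy; have : my = mx \/ my = linv mx.
    by move: mx my mxy {ex ey} => [a []] [b []] /= ->; [left|right|right|left].
  by case=> exy; move: ey; rewrite exy ?F2_letterV ?(morphgV (@autM _ f)) ex.
have := lenf _ _ ex; have := lenf _ _ ey.
by case: mx nxy {ex} => -[] ?; case: my {ey} => -[] ?.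
Qed.

End Reduced.

(** * Cancellation between palindromes *)

Section Palindromes.
Implicit Types u v : F2.

(** Inversion of a palindrome acts letter by letter; this makes cancellation
    on the left and on the right the same. *)
Lemma word_invg_pal u : palindrome u -> word u^-1 = map linv (word u).
Proof. by move=> /eqP uP; rewrite /= /inv_word -map_rev uP. Qed.

Lemma overlapVV u v : palindrome u -> palindrome v ->
  overlap u^-1 v^-1 = overlap u v.
Proof.
move=> uP vP; rewrite /overlap !word_invg_pal // lcp_map //.
exact: can_inj linvK.
Qed.

Lemma overlapV u v : palindrome u -> palindrome v ->
  overlap u v^-1 = overlap u^-1 v.
Proof.
move=> uP vP; rewrite /overlap !word_invg_pal //.
by rewrite -(lcp_map _ _ (can_inj linvK)) -map_comp (eq_map linvK) map_id.
Qed.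

Lemma overlapVr u : palindrome u -> overlap u^-1 u = 0%N.
Proof.
move=> uP; rewrite /overlap word_invg_pal //.
by case: (word u) => //= l s; rewrite (negPf (linv_neq l)).
Qed.

(** The first letters of u and u^-1 are inverse to each other, so v can start
    with only one of them. *)
Lemma overlap_dichotomy u v : palindrome u ->
  overlap u v = 0%N \/ overlap u^-1 v = 0%N.
Proof.
move=> uP; rewrite /overlap word_invg_pal //.
case: (word u) (word v) => [|l s] [|m t] /=; try by left.
have [->|] := eqVneq l m; last by left.
by right; rewrite (negPf (linv_neq m)).
Qed.

Lemma pal_inj u v : palindrome u -> palindrome v -> len u = len v ->
  (len u <= 2 * overlap u v)%N -> u = v.
Proof. by move=> /eqP uP /eqP vP luv ov; apply/val_inj/pal_eq_half. Qed.

End Palindromes.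

(** * The abelianization *)

(** Exponent sum of x (i = false) or of y (i = true). *)
Definition expo (i : bool) (u : F2) : int :=
  (\sum_(l <- word u | l.1 == i) (-1) ^+ l.2)%R.
Arguments expo i u%_g.

Lemma expoM i (u v : F2) : expo i (u * v) = (expo i u + expo i v)%R.
Proof.
rewrite /expo /=; elim: (word u) => [|l s IHs] /=; first by rewrite big_nil add0r.
have pushE w : (\sum_(m <- push l w | m.1 == i) (-1) ^+ m.2 =
    (\sum_(m <- l :: w | m.1 == i) (-1) ^+ m.2) :> int)%R.
  case: w => //= m w; case: eqP => //= ->; rewrite !big_cons /=.
  by case: (l.1 == i) => //; case: (l.2); rewrite !(expr0, expr1) addrA;
    rewrite ?subrr ?addNr add0r.
by rewrite pushE !big_cons IHs; case: ifP => // _; rewrite addrA.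
Qed.

Lemma expo1 i : expo i 1 = 0%R.
Proof. by rewrite /expo big_nil. Qed.

Lemma expoV i (u : F2) : expo i u^-1 = (- expo i u)%R.
Proof. by apply/eqP; rewrite -addr_eq0 -expoM mulVg expo1. Qed.

Lemma expo_letter i l :
  expo i (F2_letter l) = (if l.1 == i then (-1) ^+ l.2 else 0)%R.
Proof. by rewrite /expo big_cons big_nil; case: ifP => _ //; rewrite addr0. Qed.

Lemma odd_expo i u : odd `|expo i u|%N = odd (count (fun l => l.1 == i) (word u)).
Proof.
rewrite /expo; elim: (word u) => [|l s IHs]; first by rewrite big_nil.
rewrite big_cons /= oddD -IHs; case: ifP => //= _.
by case: (l.2); rewrite ?(expr0, expr1); move: (\sum_(_ <- _ | _) _)%R => z; lia.
Qed.

Lemma pal_even_expo i u : palindrome u -> ~~ odd (len u) -> ~~ odd `|expo i u|%N.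
Proof. by move=> /eqP uP ev; rewrite odd_expo pal_even_count. Qed.

(** In a palindrome of even length both letters occur evenly often; in one of
    odd length the two numbers of occurrences have an odd sum. *)
Lemma pal_expo_even u : palindrome u ->
  ~~ (odd `|expo false u|%N && odd `|expo true u|%N).
Proof.
move=> uP; have [ev|] := boolP (~~ odd (len u)).
  by rewrite (negPf (pal_even_expo _ uP ev)).
rewrite negbK !odd_expo /len -(count_predC (fun l => l.1 == false) (word u)).
rewrite oddD (@eq_count _ (predC _) (fun l => l.1 == true)) => [|[[] ?] //].
by do 2!case: odd.
Qed.

Section Abelianization.
Implicit Types f g : Aut F2.

(** Row i of the matrix of f holds the exponent sums of the image of the i-th
    generator; row vectors match the action on the right. *)
Definition entry f (i j : bool) : int := expo j (f (F2_letter (i, false))).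
Arguments entry f%_g i j.

Lemma expo_aut f u j : expo j (f u) =
  (expo false u * entry f false j + expo true u * entry f true j)%R.
Proof.
rewrite [u]F2E; elim: (word u) => [|l s IHs] /=.
  rewrite !expo1; have -> : f 1 = 1 by apply: morphg1; apply: autM.
  by rewrite expo1 !mul0r.
rewrite autM !expoM IHs !mulrDl addrACA; congr (_ + _)%R.
case: l => i e; rewrite !expo_letter /entry /=.
have -> : f (F2_letter (i, e)) =
    if e then (f (F2_letter (i, false)))^-1 else f (F2_letter (i, false)).
  by case: e => //; rewrite -(morphgV (@autM _ f)) -F2_letterV.
by case: i e => -[]; rewrite ?expoV !(expr0, expr1) !(mul0r, mul1r, mulN1r);
  rewrite ?(addr0, add0r).
Qed.

Lemma aut_entryM f g i j : entry (f * g) i j =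
  (entry f i false * entry g false j + entry f i true * entry g true j)%R.
Proof. exact: (expo_aut g (f (F2_letter (i, false))) j). Qed.

Lemma aut_entry1 i j : entry 1 i j = (i == j)%:R%R.
Proof. by rewrite /entry expo_letter; case: eqP. Qed.

Definition adet f : int :=
  (entry f false false * entry f true true -
   entry f false true * entry f true false)%R.

Arguments adet f%_g.

Lemma adetM f g : adet (f * g) = (adet f * adet g)%R.
Proof. by rewrite /adet !aut_entryM; ring. Qed.

Lemma adet_unit f : adet f = 1%R \/ adet f = (-1)%R.
Proof.
have : (adet f * adet f^-1 = 1)%R.
  by rewrite -adetM mulgV /adet !aut_entry1.
by move/(congr1 absz)/eqP; rewrite abszM muln_eq1 => /andP[/eqP ? _]; lia.
Qed.

End Abelianization.

(** * Palindromic automorphisms *)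

Section Palindromic.
Implicit Types f : PiA2.

Lemma pal_x f : palindrome (f x).
Proof. by case: f => f /= /andP[]. Qed.

Lemma pal_y f : palindrome (f y).
Proof. by case: f => f /= /andP[]. Qed.

Lemma entry_row_even f i : ~~ (odd `|entry f i false|%N && odd `|entry f i true|%N).
Proof. by apply: pal_expo_even; case: i; [apply: pal_y | apply: pal_x]. Qed.

(** A palindrome of even length would give an even row, hence an even
    determinant. *)
Lemma odd_len_x f : odd (len (f x)).
Proof.
apply: contraT => ev; have ex j := pal_even_expo j (pal_x f) ev.
have := adet_unit f; rewrite /adet.
have /= := ex false; have /= := ex true; rewrite -!/(entry f false _).
move: (entry f _ _) (entry f _ _) (entry f _ _) (entry f _ _) => a b c d oa ob ad.
have : odd `|(c * b - d * a)%R|%N by case: ad => ->.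
rewrite (_ : odd _ = odd (`|(c * b)%R| + `|(d * a)%R|)%N); last lia.
by rewrite oddD !abszM !oddM (negPf oa) (negPf ob).
Qed.

Lemma mulg_val (f g : PiA2) u : (f * g) u = g (f u).
Proof. by []. Qed.

Lemma rhoE : (rho x = y) * (rho y = x).
Proof. by rewrite /= F2_eval_x F2_eval_y. Qed.

Lemma sigmaE : (sigma x = x^-1) * (sigma y = y).
Proof. by rewrite /= F2_eval_x F2_eval_y. Qed.

Lemma deltaE : (delta x = x) * (delta y = y^-1).
Proof. by rewrite /= F2_eval_x F2_eval_y. Qed.

Lemma mu21E : (mu21 x = x) * (mu21 y = x * y * x).
Proof. by rewrite /= F2_eval_x F2_eval_y. Qed.

Lemma mu12E : (mu12 x = y * x * y) * (mu12 y = y).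
Proof. by rewrite /= F2_eval_x F2_eval_y. Qed.

End Palindromic.

(** * Word length is controlled by the abelianization *)

Section Descent.
Implicit Types f : PiA2.

Lemma rho_pair f : ((rho * f) x = f y) * ((rho * f) y = f x).
Proof. by rewrite !mulg_val !rhoE. Qed.

Lemma sigma_pair f : ((sigma * f) x = (f x)^-1) * ((sigma * f) y = f y).
Proof. by rewrite !mulg_val !sigmaE (morphgV (@autM _ f)). Qed.

Lemma delta_pair f : ((delta * f) x = f x) * ((delta * f) y = (f y)^-1).
Proof. by rewrite !mulg_val !deltaE (morphgV (@autM _ f)). Qed.

Lemma mu21_pair f : ((mu21 * f) x = f x) * ((mu21 * f) y = f x * f y * f x).
Proof. by rewrite !mulg_val !mu21E !(@autM _ f). Qed.

(** Left multiplication by generators of the palindromic group performs the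
    Nielsen moves on the pair (f x, f y); this is the move that shortens. *)
Lemma mu21V_pair f : ((mu21^-1 * f) x = f x) *
  ((mu21^-1 * f) y = (f x)^-1 * f y * (f x)^-1).
Proof.
have [] := mu21_pair (mu21^-1 * f); rewrite mulVKg => fx fy.
by rewrite fy fx !mulgA mulVg mul1g mulgK.
Qed.

(** All cancellations between f x, f y and their inverses are 0 or
    [overlap (f x) (f y)], so the latter is a bound as in [nielsen_basis]. *)
Lemma reduced_pair f :
    overlap (f x)^-1 (f y) = 0%N ->
    (2 * overlap (f x) (f y) < len (f x))%N ->
    (2 * overlap (f x) (f y) < len (f y))%N ->
  len (f x) = 1%N /\ len (f y) = 1%N.
Proof.
move=> ov0 lx ly; have [px py] := (pal_x f, pal_y f).
have letterV i : f (F2_letter (i, true)) = (f (F2_letter (i, false)))^-1.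
  by rewrite -(morphgV (@autM _ f)) -F2_letterV.
apply: (@nielsen_basis f (overlap (f x) (f y))) => [[[] []]|[[] []] [[] []]] //;
  rewrite ?letterV ?invgK ?lenV // => _;
  rewrite ?overlapVV ?overlapV -?/x -?/y //.
all: rewrite ?overlapVr ?ov0 //.
all: by rewrite overlapC ?overlapV // ov0.
Qed.

(** Multiplying by u^-1 on the left cancels [overlap u v] letters, which is
    more than half of u.  On the right the same number cancels, unless the two
    cancellations meet inside v; the result then has length at most
    2 |u| - |v|. *)
Lemma len_sandwich (u v : F2) : palindrome u -> palindrome v ->
    (len u < len v)%N -> (len u < 2 * overlap u v)%N ->
  (len (u^-1 * v * u^-1) < len v)%N.
Proof.
move=> uP vP uv ov; have e1 := len_mulVg u v.
have ultra := overlap_ultra (u^-1 * v)^-1 v^-1 u^-1.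
have e2 : (len (u^-1 * v * u^-1) + 2 * overlap (u^-1 * v)^-1 u^-1 =
           len (u^-1 * v) + len u)%N.
  by have := len_mulVg (u^-1 * v)^-1 u^-1; rewrite invgK !lenV.
have e3 : (len u + 2 * overlap (u^-1 * v)^-1 v^-1 =
           len (u^-1 * v) + len v)%N.
  by have := len_mulVg (u^-1 * v)^-1 v^-1; rewrite invgK mulgK !lenV.
have e4 : overlap v^-1 u^-1 = overlap u v by rewrite overlapVV // overlapC.
lia.
Qed.

Lemma descent f : (len (f x) < len (f y))%N ->
    overlap (f x)^-1 (f y) = 0%N ->
  (len ((f x)^-1 * f y * (f x)^-1) < len (f y))%N.
Proof.
move=> xy ov0; have := odd_len_x f.
case: (ltngtP (2 * overlap (f x) (f y)) (len (f x))).
- move=> lx _; have [] := reduced_pair ov0 lx (ltn_trans lx xy); lia.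
- by move=> ov _; apply: len_sandwich; rewrite ?pal_x ?pal_y.
- by move<-; rewrite mul2n odd_double.
Qed.

(** A large overlap would make the two palindromes of equal length equal, by
    [pal_inj], so the pair is reduced. *)
Lemma balanced f : len (f x) = len (f y) -> len (f x) = 1%N.
Proof.
wlog ov0 : f / overlap (f x)^-1 (f y) = 0%N => [main|] xy.
  have [ov0|] := overlap_dichotomy (f y) (pal_x f); last by move/main; apply.
  have := main (delta * f); rewrite !delta_pair lenV; apply=> //.
  by rewrite overlapVV ?pal_x ?pal_y.
have := odd_len_x f; case: (ltngtP (2 * overlap (f x) (f y)) (len (f x))).
- by move=> lx _; have [] // := reduced_pair ov0 lx; rewrite -xy.
- move=> ov _; have := pal_inj (pal_x f) (pal_y f) xy (ltnW ov).
  by move/(bij_inj (aut_bij f)).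
- by move<-; rewrite mul2n odd_double.
Qed.

Definition norm1 (u : F2) : int := (`|expo false u| + `|expo true u|)%R.
Arguments norm1 u%_g.

Lemma norm1V (u : F2) : norm1 u^-1 = norm1 u.
Proof. by rewrite /norm1 !expoV !normrN. Qed.

Lemma norm1_len1 (u : F2) : len u = 1%N -> norm1 u = 1%R.
Proof.
by move/len_eq1 => [[i e] ->]; rewrite /norm1 !expo_letter; case: i e => -[].
Qed.

(** The rows of two letters are independent by the determinant, so their
    entries cannot compensate each other. *)
Lemma norm1_sandwich1 f : len (f x) = 1%N -> len (f y) = 1%N ->
  (norm1 (f x) < norm1 (f x * f y * f x))%R.
Proof.
move=> /len_eq1[l fx] /len_eq1[m fy]; have := adet_unit f.
rewrite /norm1 !expoM /adet /entry -/x -/y fx fy !expo_letter.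
by case: l m {fx fy} => -[] [] [[] []] /= [].
Qed.

(** Induction along [descent].  The second inequality is what makes the
    induction work: once adding 2 (f x) to a row increases its norm,
    convexity of the norm keeps it increasing. *)
Lemma norm1_descent n f : (len (f x) + len (f y) < n)%N ->
    (len (f x) < len (f y))%N -> overlap (f x)^-1 (f y) = 0%N ->
  (norm1 (f x) < norm1 (f y))%R /\
  (norm1 ((f x)^-1 * f y * (f x)^-1) < norm1 (f y))%R.
Proof.
elim: n f => [|n IHn] f //; rewrite ltnS => lt_n xy ov0.
have := descent xy ov0; set c := _ * f y * _ => cy.
have gP := mu21V_pair f; set g := mu21^-1 * f in gP; rewrite -/c in gP.
have yE : f y = f x * c * f x by rewrite /c !mulgA mulgV mul1g mulgVK.
have [pc px] : palindrome c /\ palindrome (f x).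
  by have := pal_y g; rewrite gP pal_x.
have tri : (2 * norm1 (f x) - norm1 c <= norm1 (f y))%R.
  rewrite yE /norm1 !expoM; lia.
have conv : (2 * norm1 c - norm1 ((f x)^-1 * c * (f x)^-1) <= norm1 (f y))%R.
  rewrite yE /norm1 !expoM !expoV; lia.
case: (ltngtP (len c) (len (f x))) => [cx|xc|exc].
- suff : (norm1 c < norm1 (f x))%R by lia.
  have IH (h : PiA2) : (len (h x) < len (h y))%N ->
      (len (h x) + len (h y) < n)%N -> (norm1 (h x) < norm1 (h y))%R.
    move=> hxy hn; have [ov|ov] := overlap_dichotomy (h y) (pal_x h); last first.
      by have [] := IHn h hn hxy ov.
    have := IHn (sigma * h); rewrite !sigma_pair invgK lenV norm1V.
    by case=> //.
  by have := IH (rho * g); rewrite !rho_pair !gP; apply=> //; lia.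
- have [ov|ov] := overlap_dichotomy c px.
    (* Here [descent] would apply to the pair (f x, c^-1) and say that (f y)^-1
       is shorter than c^-1. *)
    have := descent (f := delta * g); rewrite !delta_pair !gP lenV.
    rewrite overlapVV // => /(_ xc ov).
    have -> : (f x)^-1 * c^-1 * (f x)^-1 = (f y)^-1 by rewrite yE !invgM !mulgA.
    rewrite lenV; lia.
  have := IHn g; rewrite !gP => -[] //; first lia.
  by lia.
- have cx1 : len (f x) = 1%N by have := @balanced g; rewrite !gP; apply.
  have := @norm1_sandwich1 g; rewrite !gP -yE exc cx1 => /(_ erefl erefl) lt.
  by rewrite (norm1_len1 (u := c)) ?exc // -(norm1_len1 cx1).
Qed.

(** Inverting f x, if necessary, puts the pair in the position of [norm1_descent]. *)
Lemma norm1_lt f : (len (f x) < len (f y))%N -> (norm1 (f x) < norm1 (f y))%R.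
Proof.
move=> xy; have [ov|ov] := overlap_dichotomy (f y) (pal_x f); last first.
  by have [] := norm1_descent (ltnSn _) xy ov.
have := @norm1_descent _ (sigma * f) (ltnSn _).
by rewrite !sigma_pair invgK lenV norm1V; case.
Qed.

(** Both rows have norm 1, so by [norm1_lt] neither of f x, f y is longer than
    the other, and by [balanced] both are letters. *)
Lemma entry_faithful f : (forall i j, entry f i j = (i == j)%:R%R) -> f = 1.
Proof.
move=> f1; have Nx : norm1 (f x) = 1%R by rewrite /norm1 -!/(entry f false _) !f1.
have Ny : norm1 (f y) = 1%R by rewrite /norm1 -!/(entry f true _) !f1.
have xy : len (f x) = len (f y).
  have := @norm1_lt f; have := @norm1_lt (rho * f); rewrite !rho_pair Nx Ny.
  by case: ltngtP => // _ lt1 lt2; [have := lt1 isT|have := lt2 isT].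
have fx : f x = x.
  have [l fx] := len_eq1 (balanced xy).
  have := f1 false false; have := f1 false true; rewrite /entry -/x fx !expo_letter.
  by case: l {fx} => -[] [].
have fy : f y = y.
  have [m fy] := len_eq1 (etrans (esym xy) (balanced xy)).
  have := f1 true false; have := f1 true true; rewrite /entry -/y fy !expo_letter.
  by case: m {fy} => -[] [].
apply/val_inj/eq_aut => u; apply: (@F2_morph_ext _ f id) => //.
exact: autM.
Qed.

Lemma entryM (f g : PiA2) i j : entry (f * g) i j =
  (entry f i false * entry g false j + entry f i true * entry g true j)%R.
Proof. by rewrite -(aut_entryM f g). Qed.

Lemma entry1 i j : entry (1 : PiA2) i j = (i == j)%:R%R.
Proof. exact: aut_entry1. Qed.

Lemma entry_inj (f g : PiA2) : (forall i j, entry f i j = entry g i j) -> f = g.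
Proof.
move=> fg; apply: (mulIg g^-1); rewrite mulgV; apply: entry_faithful => i j.
have -> : entry (f * g^-1) i j = entry (g * g^-1) i j by rewrite !entryM !fg.
by rewrite mulgV entry1.
Qed.

End Descent.

(** * Matrices of palindromic automorphisms *)

Section Matrices.
Implicit Types f g h : PiA2.

Definition has_mx f (a b c d : int) : Prop :=
  [/\ entry f false false = a, entry f false true = b,
      entry f true false = c & entry f true true = d].
Arguments has_mx f%_g (a b c d)%_R.

Lemma has_mx_inj f g a b c d :
  has_mx f a b c d -> has_mx g a b c d -> f = g.
Proof.
by case=> fa fb fc fd [ga gb gc gd]; apply: entry_inj => -[] [];
  rewrite ?(fa, fb, fc, fd) ?(ga, gb, gc, gd).
Qed.

Lemma has_mxM f g a b c d p q r s :
    has_mx f a b c d -> has_mx g p q r s ->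
  has_mx (f * g) (a * p + b * r) (a * q + b * s) (c * p + d * r) (c * q + d * s).
Proof.
by case=> fa fb fc fd [ga gb gc gd];
  split; rewrite entryM ?(fa, fb, fc, fd) ?(ga, gb, gc, gd).
Qed.

Lemma mx_one : has_mx 1 1 0 0 1.
Proof. by split; rewrite entry1. Qed.

Lemma mx_sigma : has_mx sigma (-1) 0 0 1.
Proof.
by split; rewrite /entry -?/x -?/y !sigmaE ?expoV expo_letter ?oppr0.
Qed.

Lemma mx_delta : has_mx delta 1 0 0 (-1).
Proof.
by split; rewrite /entry -?/x -?/y !deltaE ?expoV expo_letter ?oppr0.
Qed.

Lemma mx_rho : has_mx rho 0 1 1 0.
Proof. by split; rewrite /entry -?/x -?/y !rhoE expo_letter. Qed.

Lemma mx_mu12 : has_mx mu12 1 2 0 1.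
Proof. by split; rewrite /entry -?/x -?/y !mu12E ?expoM !expo_letter. Qed.

Lemma mx_mu21 : has_mx mu21 1 0 2 1.
Proof. by split; rewrite /entry -?/x -?/y !mu21E ?expoM !expo_letter. Qed.

Lemma has_mx_exists f : exists a b c d, has_mx f a b c d.
Proof. by do 4!eexists. Qed.

Lemma mx_mu12V : has_mx mu12^-1 1 (-2) 0 1.
Proof.
have [a [b [c [d m]]]] := has_mx_exists mu12^-1.
have [] := has_mxM mx_mu12 m; have [] := mx_one; rewrite mulgV.
by move=> -> -> -> -> e1 e2 e3 e4; case: m => ? ? ? ?; split; lia.
Qed.

(** The equations say M(f) M(h) = M(h) M(f ^ h); in this form they involve no
    inverse and are linear once M(h) is known. *)
Lemma has_mxJ f h a b c d p q r s : has_mx f a b c d -> has_mx h p q r s ->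
  exists a' b' c' d', has_mx (f ^ h) a' b' c' d' /\
   [/\ (a * p + b * r = p * a' + q * c')%R, (a * q + b * s = p * b' + q * d')%R,
       (c * p + d * r = r * a' + s * c')%R &
       (c * q + d * s = r * b' + s * d')%R].
Proof.
move=> mf mh; have [a' [b' [c' [d' mfh]]]] := has_mx_exists (f ^ h).
exists a', b', c', d'; split=> //; have := has_mxM mf mh.
by rewrite conjgC; case: (has_mxM mh mfh) => e1 e2 e3 e4 [];
  rewrite e1 e2 e3 e4.
Qed.

Lemma mxJ_mu12 f a b c d : has_mx f a b c d ->
  has_mx (f ^ mu12) (a - 2 * c) (b + 2 * a - 2 * d - 4 * c) c (d + 2 * c).
Proof.
move=> mf; have [? [? [? [? [[m1 m2 m3 m4] []]]]]] := has_mxJ mf mx_mu12.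
by move=> *; split; lia.
Qed.

Lemma mxJ_mu12V f a b c d : has_mx f a b c d ->
  has_mx (f ^ mu12^-1) (a + 2 * c) (b - 2 * a + 2 * d - 4 * c) c (d - 2 * c).
Proof.
move=> mf; have [? [? [? [? [[m1 m2 m3 m4] []]]]]] := has_mxJ mf mx_mu12V.
by move=> *; split; lia.
Qed.

Lemma mxJ_rho f a b c d : has_mx f a b c d -> has_mx (f ^ rho) d c b a.
Proof.
move=> mf; have [? [? [? [? [[m1 m2 m3 m4] []]]]]] := has_mxJ mf mx_rho.
by move=> *; split; lia.
Qed.

Lemma mxJ_sigma f a b c d : has_mx f a b c d ->
  has_mx (f ^ sigma) a (- b) (- c) d.
Proof.
move=> mf; have [? [? [? [? [[m1 m2 m3 m4] []]]]]] := has_mxJ mf mx_sigma.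
by move=> *; split; lia.
Qed.

(** Each row has an even entry ([entry_row_even]) and the determinant is odd,
    so mod 2 the matrix is the identity or the swap. *)
Lemma has_mx_mod2 f p q r s : has_mx f p q r s ->
  [/\ odd `|p|%N, odd `|s|%N, ~~ odd `|q|%N & ~~ odd `|r|%N] \/
  [/\ odd `|q|%N, odd `|r|%N, ~~ odd `|p|%N & ~~ odd `|s|%N].
Proof.
case=> mp mq mr ms; have := entry_row_even f false; have := entry_row_even f true.
have := adet_unit f; rewrite /adet mp mq mr ms => det.
have : odd `|(p * s - q * r)%R|%N by case: det => ->.
rewrite (_ : odd _ = odd (`|(p * s)%R| + `|(q * r)%R|)%N); last lia.
rewrite oddD !abszM !oddM.
by do 4!case: odd => //=; by [left | right].
Qed.

End Matrices.
Arguments has_mx f%_g (a b c d)%_R.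

(** * Conjugacy classes of involutions in a group *)

Section ConjugacyClasses.
Variable G : groupType.
Implicit Types g h : G.

Lemma conj_classJ g h : conj_class (g ^ h) = conj_class g.
Proof.
apply/seteqP; split=> _ [k _ <-].
  by exists (h * k); rewrite ?conjgM.
by exists (h^-1 * k); rewrite // -conjgM mulVKg.
Qed.

Lemma eq_conj_class g h : conj_class g = conj_class h ->
  exists k, g ^ k = h.
Proof.
move=> gh; have : conj_class g h by rewrite gh; exists 1; rewrite ?conjg1.
by case=> k _ <-; exists k.
Qed.

Lemma involutionP g : involution g <-> g * g = 1 /\ g <> 1.
Proof.
split=> [[_ g2 /(_ 1%N isT) g1]|[g2 g1]]; first by split.
by split=> // -[|[|]].
Qed.

End ConjugacyClasses.

(** * Classification of the involutions *)

Lemma mulz_eq1 (a b : int) :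
  (a * b = 1)%R -> ((a = 1 /\ b = 1) \/ (a = -1 /\ b = -1))%R.
Proof.
move=> ab; have /eqP := congr1 absz ab; rewrite abszM muln_eq1.
by move=> /andP[/eqP a1 /eqP b1]; have [] : a = 1%R \/ a = (-1)%R; nia.
Qed.

Lemma card_set_uniq (T : eqType) (x0 : T) (s : seq T) :
  uniq s -> ([set` s] #= `I_(size s))%classic%card.
Proof.
move=> s_uniq.
have -> : [set` s]%classic = [set nth x0 s i | i in `I_(size s)]%classic.
  apply/seteqP; split=> [z /= zs|_ [i /= lt_i <-]]; last exact: mem_nth.
  by exists (index z s); rewrite /= ?index_mem ?nth_index.
apply: inj_card_eq => i j; rewrite !inE /= => lt_i lt_j /eqP.
by rewrite nth_uniq // => /eqP.
Qed.

Section Classification.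
Implicit Types f g h : PiA2.

Definition reps : seq PiA2 :=
  [:: sigma; sigma * delta; rho; mu12 * sigma; mu21 * sigma].

Definition represented f : Prop :=
  exists2 g, g \in reps & conj_class g = conj_class f.

Lemma representedJ f h : represented (f ^ h) -> represented f.
Proof. by case=> g gr; rewrite conj_classJ; exists g. Qed.

Lemma mx_sigma_delta : has_mx (sigma * delta) (-1) 0 0 (-1).
Proof. by case: (has_mxM mx_sigma mx_delta) => *; split; lia. Qed.

Lemma mx_mu12_sigma : has_mx (mu12 * sigma) (-1) 2 0 1.
Proof. by case: (has_mxM mx_mu12 mx_sigma) => *; split; lia. Qed.

Lemma mx_mu21_sigma : has_mx (mu21 * sigma) (-1) 0 (-2) 1.
Proof. by case: (has_mxM mx_mu21 mx_sigma) => *; split; lia. Qed.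

Lemma represented_mx f g a b c d : g \in reps ->
  has_mx g a b c d -> has_mx f a b c d -> represented f.
Proof. by move=> gr mg mf; exists g => //; rewrite (has_mx_inj mf mg). Qed.

(** Conjugation by mu12 and its inverse changes b by 4a = 4 or -4.  As b is
    even, it can be brought to one of 0, 2, -2. *)
Lemma represented_triangular f a b :
  has_mx f a b 0 (- a) -> `|a|%N = 1%N -> represented f.
Proof.
have [n] := ubnP `|b|%N; elim: n f a b => // n IHn f a b bn mf a1.
have bev : ~~ odd `|b|%N by case: (has_mx_mod2 mf) => [[]|[]] //; rewrite a1.
have [b_big|b_small] := leqP 3 `|b|%N.
  have [same|opp] : (0 < a * b \/ a * b < 0)%R by nia.
    apply: (@representedJ f mu12^-1); apply: (IHn _ a (b - 4 * a)%R) => //; first nia.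
    by case: (mxJ_mu12V mf) => *; split; lia.
  apply: (@representedJ f mu12); apply: (IHn _ a (b + 4 * a)%R) => //; first nia.
  by case: (mxJ_mu12 mf) => *; split; lia.
have bP : (b = 0 \/ b = 2 \/ b = -2)%R by lia.
have aP : a = 1%R \/ a = (-1)%R by lia.
have rE : [/\ sigma \in reps, mu12 * sigma \in reps & mu21 * sigma \in reps].
  by rewrite !inE !eqxx !orbT.
case: rE => r1 r2 r3.
(* For a = 1, conjugation by rho turns the matrix into a lower triangular one
   with first entry -1; the sign of b = 2 or b = -2 is changed by mu12^-1. *)
case: aP bP mf => -> [|[]] -> mf.
- apply: (@representedJ f rho); apply: (represented_mx r1 mx_sigma).
  by case: (mxJ_rho mf) => *; split; lia.
- apply: (@representedJ f mu12^-1); apply: (@representedJ _ rho).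
  apply: (represented_mx r3 mx_mu21_sigma).
  by case: (mxJ_rho (mxJ_mu12V mf)) => *; split; lia.
- apply: (@representedJ _ rho); apply: (represented_mx r3 mx_mu21_sigma).
  by case: (mxJ_rho mf) => *; split; lia.
- by apply: (represented_mx r1 mx_sigma); case: mf => *; split; lia.
- by apply: (represented_mx r2 mx_mu12_sigma); case: mf => *; split; lia.
- apply: (@representedJ f mu12^-1); apply: (represented_mx r2 mx_mu12_sigma).
  by case: (mxJ_mu12V mf) => *; split; lia.
Qed.

(** Euclidean descent on |a|.  By symmetry under rho, |c| <= |b|; then
    c^2 <= |bc| = a^2 - 1 < a^2 when |a| > 1, and c is not 0, so that a - 2c or
    a + 2c is smaller than a in absolute value. *)
Lemma represented_trace0 f a b c :
  has_mx f a b c (- a) -> (a * a + b * c = 1)%R -> represented f.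
Proof.
have [n] := ubnP `|a|%N; elim: n f a b c => // n IHn f a b c an.
wlog le_cb : f a b c an / (`|c| <= `|b|)%N => [main|] mf det.
  have [/main|/ltnW bc] := leqP `|c|%N `|b|%N; first by apply; eassumption.
  apply: (@representedJ f rho); apply: (main _ (- a)%R c b) => //.
  - by rewrite abszN.
  - by rewrite opprK; exact: mxJ_rho.
  - lia.
have [a0|[a1|a2]] : `|a|%N = 0%N \/ `|a|%N = 1%N \/ (1 < `|a|)%N by lia.
- have rr : rho \in reps by rewrite !inE eqxx !orbT.
  have {}a0 : a = 0%R by lia.
  have [[eb ec]|[eb ec]] : ((b = 1 /\ c = 1) \/ (b = -1 /\ c = -1))%R.
  - by apply: mulz_eq1; rewrite -det a0 mul0r add0r.
  - subst.
    by apply: (represented_mx rr mx_rho); case: mf => *; split; lia.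
  subst; apply: (@representedJ f sigma); apply: (represented_mx rr mx_rho).
  by case: (mxJ_sigma mf) => *; split; lia.
- have c0 : c = 0%R by nia.
  by subst; apply: (represented_triangular mf a1).
have ca : (0 < `|c| < `|a|)%N by nia.
have [same|opp] : (0 < a * c \/ a * c < 0)%R by nia.
- apply: (@representedJ f mu12).
  apply: (IHn _ (a - 2 * c)%R (b + 4 * a - 4 * c)%R c); [nia| |nia].
  by case: (mxJ_mu12 mf) => *; split; lia.
- apply: (@representedJ f mu12^-1).
  apply: (IHn _ (a + 2 * c)%R (b - 4 * a - 4 * c)%R c); [nia| |nia].
  by case: (mxJ_mu12V mf) => *; split; lia.
Qed.

(** The off-diagonal entries of the square are b (a + d) and c (a + d): if the
    trace is not 0 then the matrix is 1 or -1, and [has_mx_inj] identifies f. *)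
Lemma involution_represented f : involution f -> represented f.
Proof.
move=> /involutionP[ff f1]; have [a [b [c [d mf]]]] := has_mx_exists f.
have := has_mxM mf mf; rewrite ff; case=> e1 e2 e3 e4.
have [m1 m2 m3 m4] := mx_one.
move: e1 e2 e3 e4; rewrite {}m1 {}m2 {}m3 {}m4 => e1 e2 e3 e4.
have [tr0|tr] := eqVneq (a + d)%R 0%R.
  apply: (represented_trace0 (a := a) (b := b) (c := c)) => //.
  by case: mf => *; split; lia.
have b0 : b = 0%R by nia.
have c0 : c = 0%R by nia.
have [[a1 d1]|[a1 d1]] : ((a = 1 /\ d = 1) \/ (a = -1 /\ d = -1))%R.
- have /mulz_eq1 ea : (a * a = 1)%R by rewrite e1 b0 mul0r addr0.
  have /mulz_eq1 ed : (d * d = 1)%R by rewrite e4 c0 mul0r add0r.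
  lia.
- by case: f1; apply: has_mx_inj mx_one; subst.
by apply: (represented_mx _ mx_sigma_delta); [rewrite !inE eqxx !orbT|subst].
Qed.

Lemma reps_involution g : g \in reps -> involution g.
Proof.
have inv f a b c d : has_mx f a b c d -> [/\ a * a + b * c = 1,
    b * (a + d) = 0, c * (a + d) = 0, d * d + b * c = 1 & d <> 1 \/ a <> 1]%R ->
    involution f.
  move=> mf [e1 e2 e3 e4 n1]; apply/involutionP; split.
    apply: has_mx_inj mx_one; case: (has_mxM mf mf) => h1 h2 h3 h4.
    by split; rewrite ?(h1, h2, h3, h4); lia.
  by move=> f1; move: mf; rewrite f1 => -[]; case: mx_one => -> -> -> ->; lia.
rewrite !inE => /or4P[/eqP->|/eqP->|/eqP->|/orP[]/eqP->].
- by apply: (inv _ _ _ _ _ mx_sigma); split; lia.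
- by apply: (inv _ _ _ _ _ mx_sigma_delta); split; lia.
- by apply: (inv _ _ _ _ _ mx_rho); split; lia.
- by apply: (inv _ _ _ _ _ mx_mu12_sigma); split; lia.
- by apply: (inv _ _ _ _ _ mx_mu21_sigma); split; lia.
Qed.

(** H = (p, q; r, s) is the matrix of a conjugating element. *)
Lemma conj_class_intertwiner f g a b c d a' b' c' d' :
    has_mx f a b c d -> has_mx g a' b' c' d' -> conj_class f = conj_class g ->
  exists p q r s,
    [/\ (a * p + b * r = p * a' + q * c')%R, (a * q + b * s = p * b' + q * d')%R,
       (c * p + d * r = r * a' + s * c')%R &
       (c * q + d * s = r * b' + s * d')%R] /\
  ([/\ odd `|p|%N, odd `|s|%N, ~~ odd `|q|%N & ~~ odd `|r|%N] \/
  [/\ odd `|q|%N, odd `|r|%N, ~~ odd `|p|%N & ~~ odd `|s|%N]).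
Proof.
move=> mf mg /eq_conj_class[h fh].
have [p [q [r [s mh]]]] := has_mx_exists h; exists p, q, r, s.
split; last exact: has_mx_mod2 mh.
have [? [? [? [? []]]]] := has_mxJ mf mh.
by rewrite fh => -[<- <- <- <-]; case: mg => -> -> -> ->.
Qed.

End Classification.

Ltac rep_mx g :=
  match g with
  | sigma => constr:(mx_sigma)
  | sigma * delta => constr:(mx_sigma_delta)
  | rho => constr:(mx_rho)
  | mu12 * sigma => constr:(mx_mu12_sigma)
  | mu21 * sigma => constr:(mx_mu21_sigma)
  end.

(** For two different representatives the intertwining equations exclude both
    possible residues of H mod 2.  For example sigma and mu12 sigma give
    r = 0 and q = -p: the former excludes the swap, the latter the identity. *)
Lemma conj_class_reps_inj : {in reps &, injective (@conj_class PiA2)}.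
Proof.
move=> f g; rewrite !inE.
move=> /or4P[/eqP->|/eqP->|/eqP->|/orP[]/eqP->];
  move=> /or4P[/eqP->|/eqP->|/eqP->|/orP[]/eqP->] //;
  match goal with |- conj_class ?u = conj_class ?v -> _ =>
    let mu := rep_mx u in let mv := rep_mx v in
    move=> /(conj_class_intertwiner mu mv) [p [q [r [s [[e1 e2 e3 e4] odds]]]]]
  end; case: odds => -[? ? ? ?]; lia.
Qed.

Lemma card_reps : ([set` reps] #= `I_5)%classic%card.
Proof.
have u : uniq reps.
  pose M (f : PiA2) : int * int * int * int :=
    (entry f false false, entry f false true,
     entry f true false, entry f true true).
  have ME f a b c d : has_mx f a b c d -> M f = (a, b, c, d).
    by rewrite /M => -[-> -> -> ->].
  suff : uniq (map M reps) by apply: map_uniq.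
  rewrite /= (ME _ _ _ _ _ mx_sigma).
  rewrite (ME _ _ _ _ _ mx_sigma_delta) (ME _ _ _ _ _ mx_rho).
  by rewrite (ME _ _ _ _ _ mx_mu12_sigma) (ME _ _ _ _ _ mx_mu21_sigma).
exact: (card_set_uniq 1 u).
Qed.

Local Open Scope classical_set_scope.
Local Open Scope card_scope.

Theorem theorem3p10 :
  involution_classes PiA2 #= `I_5 /\
  involution_classes PiA2 =
    [set conj_class g | g in
      [set` [:: sigma; sigma * delta; rho; mu12 * sigma; mu21 * sigma]]].
Proof.
have classes : involution_classes PiA2 = [set conj_class g | g in [set` reps]].
  apply/seteqP; split=> [C [f finv ->]|C [g gr <-]].
    by have [g gr gf] := involution_represented finv; exists g.
  by exists g => //; exact: reps_involution.
split=> //; rewrite classes; apply: card_eq_trans card_reps.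
apply: inj_card_eq => f g; rewrite !inE; exact: conj_class_reps_inj.
Qed.
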